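(* Let $(\mathcal{A},\Phi)$ be a unital complex $*$-algebra with a state. Suppose $X,Y\in\mathcal{A}$ are self-adjoint, non-degenerate, Boolean independent with respect to $\Phi$, and there are numbers $\alpha,\alpha_0,C,a,b\in\mathbb{R}$ such that $$\Phi[X\mid X+Y]=\alpha(X+Y)+\alpha_0$$ and $$\mathrm{Var}[X\mid X+Y]=C\bigl(1+a(X+Y)+b(X+Y)^2\bigr).$$ Then $X$ and $Y$ have Bernoulli distributions.
   Context: A state is a unital linear functional with $\Phi[Z^*]=\overline{\Phi[Z]}$, $\Phi[Z^*Z]\ge0$. The distribution of a self-adjoint $X$ with respect to $\Phi$ is the functional $P\mapsto\Phi[P(X)]$ on $\mathbb{C}[x]$; $X$ is non-degenerate if its distribution is not a point mass, i.e. $\Phi[X^2]\ne\Phi[X]^2$. $X,Y$ are Boolean independent if $\Phi[Z_1\cdots Z_n]=\Phi[Z_1]\cdots\Phi[Z_n]$ whenever the $Z_i$ are, alternately, positive powers $X^{v}$ or $Y^{v}$, $v\ge1$ (neighbouring factors being powers of different variables). $\Phi[\,\cdot\mid S]$, for self-adjoint $S$, is the orthogonal projection in $L^2(\mathcal{A},\Phi)$ (inner product $\langle Z,W\rangle=\Phi[Z^*W]$) onto the closure of the polynomials in $S$, so $\Phi[Z\mid S]=Q(S)$ with $Q$ a polynomial means $\Phi[P(S)Z]=\Phi[P(S)Q(S)]$ for all polynomials $P$. $\mathrm{Var}[X\mid S]=\Phi\bigl[(X-\Phi[X\mid S])^2\mid S\bigr]$. A Bernoulli distribution is a probability measure on $\mathbb{R}$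 supported on exactly two points (normalized to mean zero and variance one: $\frac{1}{1+\beta^2}\delta_\beta+\frac{\beta^2}{1+\beta^2}\delta_{-1/\beta}$). *)

(* Defs.v *)
From HB Require Import structures.
From mathcomp Require Import all_boot all_order all_algebra.
From mathcomp Require Import reals complex.

Set Implicit Arguments.
Unset Strict Implicit.
Unset Printing Implicit Defensive.

Import Order.TTheory GRing.Theory Num.Theory.
Local Open Scope ring_scope.

HB.mixin Record hasStar (K : numClosedFieldType) A of GRing.Algebra K A := {
  star : A -> A;
  starK : involutive star;
  starD : {morph star : x y / x + y};
  starM : forall x y, star (x * y) = star y * star x;
  starZ : forall (k : K) x, star (k *: x) = Num.conj k *: star x
}.

#[short(type="starAlgType")]
HB.structure Definition StarAlgebra (K : numClosedFieldType) :=
  { A of hasStar K A & GRing.Algebra K A }.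

Section NoncommutativeProbability.
Variables (R : realType) (A : starAlgType R[i]).
Implicit Types (Phi : {scalar A}) (X Y S Z : A) (P Q V : {poly R[i]}).

(* On R[i], 0 <= z says that z is real and nonnegative. *)
Record is_state Phi : Prop := IsState {
  state_unital : Phi 1 = 1;
  state_star : forall Z, Phi (star Z) = Num.conj (Phi Z);
  state_pos : forall Z, 0 <= Phi (star Z * Z)
}.

Definition self_adjoint X : Prop := star X = X.

Definition distribution Phi X : {poly R[i]} -> R[i] :=
  fun P => Phi (horner_alg X P).

(* For self-adjoint X and a state Phi, being degenerate is equivalent to
   Phi (X ^+ 2) = Phi X ^+ 2. *)
Definition non_degenerate Phi X : Prop :=
  ~ exists x : R, forall P, distribution Phi X P = P.[x%:C%C].

(* The two-point measure p delta_x + (1 - p) delta_y, as a functional on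
   polynomials; its mean and variance are not normalized. *)
Definition bernoulli Phi X : Prop :=
  exists x y p : R, [/\ x != y, 0 < p, p < 1 &
    forall P, distribution Phi X P =
      p%:C%C * P.[x%:C%C] + (1 - p)%:C%C * P.[y%:C%C]].

(* The entry (true, v) of s stands for the factor X ^+ v, and (false, v)
   for Y ^+ v. *)
Definition boolean_independent Phi X Y : Prop :=
  forall s : seq (bool * nat),
    sorted (fun u w => u.1 != w.1) s -> all (fun u => (0 < u.2)%N) s ->
    Phi (\prod_(u <- s) (if u.1 then X else Y) ^+ u.2) =
    \prod_(u <- s) Phi ((if u.1 then X else Y) ^+ u.2).

(* Phi[Z | S] = Q(S): for self-adjoint S, Z - Q(S) is orthogonal to every
   polynomial in S for the inner product <Z, W> = Phi (star Z * W), which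
   characterizes Q(S) as the projection of Z because Q(S) is itself a
   polynomial in S.  Phi need not be a trace, so the order of the factors
   matters. *)
Definition cond_exp_eq Phi S Z Q : Prop :=
  forall P, Phi (horner_alg S P * Z) = Phi (horner_alg S P * horner_alg S Q).

(* Var[X | S] = V(S), when Phi[X | S] is a polynomial Q in S. *)
Definition cond_var_eq Phi S X V : Prop :=
  exists2 Q, cond_exp_eq Phi S X Q
           & cond_exp_eq Phi S ((X - horner_alg S Q) ^+ 2) V.

End NoncommutativeProbability.

(* Main.v *)
Require Import Defs.
From HB Require Import structures.
From mathcomp Require Import all_boot all_order all_algebra.
From mathcomp Require Import reals complex.
From mathcomp Require Import ring lra.

Set Implicit Arguments.
Unset Strict Implicit.
Unset Printing Implicit Defensive.

(** Write S = X + Y, s_n = Phi(S^n), and let x = alpha * s_1 + alpha0 be the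
mean of X.

Boolean independence evaluates every mixed moment that occurs.  Since
S^(n+1) X^k = S^n X^(k+1) + S^n Y X^k and the last block X^k of the second
term factors out,
  Phi(S^n X^(k+1)) = Phi(S^(n+1) X^k) - Phi(S^n Y) Phi(X^k)
([boolean_strip_left]) and Phi(S^n X Y) = Phi(S^n X) Phi(Y)
([boolean_strip_right]).  With the regression Phi[X | S] = alpha S + alpha0,
which expresses Phi(S^n X) through the s_n, every Phi(S^n X^k) becomes a
function of the moments of S and of the lower moments of X.

Substituted in the conditional variance, these rules cancel almost
everything and leave a linear relation ([cond_var_moments]):
  alpha (1 - alpha) (s_(n+2) - s_1 s_(n+1))
    = C (s_n + a s_(n+1) + b s_(n+2)).
Comparing variances shows Var X = alpha Var S and Var Y = (1 - alpha) Var S;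
both are positive, hence alpha (1 - alpha) <> 0 and Var S <> 0.  Then the
leading coefficient alpha (1 - alpha) - C b cannot vanish, and the relation
says that s_n satisfies the second-order recurrence with characteristic
polynomial (t - s_1)(t - c) - Var S ([moment_recurrence]).

That form of recurrence passes to the summands with the same c: the moments
of X obey the one of (t - x)(t - c) - alpha Var S ([summand_recurrence]),
and Y is the same case with 1 - alpha and - alpha0.  In terms of Boolean
cumulants: those of order at least two of S are Var S * c^(n-2), and the
cumulants of X and Y are proportional to them from order two on.  Finally
(t - x)(t - c) - v with v > 0 is negative at t = x, so it has two real roots
strictly on either side of the mean, and a unital functional with this
recurrence and mean x is the two-point measure on the roots
([bernoulli_of_recurrence]).

The polynomial representing Phi[X | S] need not be unique when S has finite
support, and the conditional variance may use another one; two choices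
differ by a null vector D of the state, for which Phi(Z D) = 0 for every Z
([null_vector], [cond_var_with]). *)

Import Order.TTheory GRing.Theory Num.Theory.
Local Open Scope ring_scope.

(** * Null vectors of positive functionals *)

Section StarAlgebras.
Variables (K : numClosedFieldType) (A : starAlgType K).
Implicit Types (D Z : A).

Lemma star1 : star (1 : A) = 1.
Proof. by rewrite -[LHS]mulr1 -[X in _ * X]starK -starM mulr1 starK. Qed.

Lemma scalarZ (Phi : {scalar A}) (k : K) Z : Phi (k *: Z) = k * Phi Z.
Proof. exact: linearZ. Qed.

(** The Cauchy-Schwarz inequality against a vector of norm zero: otherwise the
squared norm of star Z + k D, which is affine in k, would be negative for
a suitable k. *)
Lemma null_vector (Phi : {scalar A}) D :
    (forall Z, Phi (star Z) = Num.conj (Phi Z)) ->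
    (forall Z, 0 <= Phi (star Z * Z)) ->
  Phi (star D * D) = 0 -> forall Z, Phi (Z * D) = 0.
Proof.
move=> Phi_star Phi_pos D0 Z; apply/eqP/negP => /negP w0.
set w := Phi (Z * D) in w0.
set N := Phi (Z * star Z).
have N_ge0 : 0 <= N by have := Phi_pos (star Z); rewrite starK.
have N_real : Num.conj N = N by apply/conj_Creal/ger0_real.
have h : 0 <= N - (N + 1).
  (* k makes the cross terms k w + conj (k w) add up to - (N + 1) *)
  pose k := - (N + 1) / (2 * w).
  suff <- : Phi (star (star Z + k *: D) * (star Z + k *: D)) = N - (N + 1).
    exact: Phi_pos.
  have wC : Phi (star D * star Z) = Num.conj w by rewrite -starM Phi_star.
  rewrite starD starK starZ mulrDl !mulrDr -!scalerAl -!scalerAr !linearD !scalarZ.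
  rewrite D0 wC -/N -/w -rmorphM.
  have -> : k * w = - (N + 1) / 2 by rewrite /k; field.
  by rewrite rmorphM rmorphN rmorphD rmorph1 fmorphV rmorph_nat /= N_real; field.
by move: h; rewrite opprD addrA subrr sub0r oppr_ge0 ler10.
Qed.

End StarAlgebras.

(** * Second-order recurrences *)

(** If K - C b were zero, the hypothesis would read
(a + b s_1) s_(n+1) = - s_n; its cases n = 0 and n = 1 give
(a + b s_1) (s_2 - s_1^2) = 0, hence a + b s_1 = 0 and s_0 = 0.  The
coefficient of s_n in the conclusion is C / (K - C b), rewritten with the
case n = 0 so that the variance s_2 - s_1^2 appears. *)
Lemma moment_recurrence (F : fieldType) (s : nat -> F) (K C a b : F) :
    s 0%N = 1 -> s 2%N - s 1%N ^+ 2 != 0 -> K != 0 ->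
    (forall n, K * (s n.+2 - s 1%N * s n.+1) = C * (s n + a * s n.+1 + b * s n.+2)) ->
  forall n, s n.+2 =
    (s 1%N + C * (a + b * s 1%N) / (K - C * b)) * s n.+1
    - (C * (a + b * s 1%N) / (K - C * b) * s 1%N - (s 2%N - s 1%N ^+ 2)) * s n.
Proof.
move=> s0 var_neq0 K_neq0 rec.
have L_neq0 : K - C * b != 0.
  apply/eqP => /eqP; rewrite subr_eq0 => /eqP KE.
  have C_neq0 : C != 0 by apply: contraNneq K_neq0 => C0; rewrite KE C0 mul0r.
  have relation n : (a + b * s 1%N) * s n.+1 = - s n.
    apply: (mulfI C_neq0); apply/eqP; rewrite -subr_eq0; apply/eqP.
    transitivity (C * (s n + a * s n.+1 + b * s n.+2) - K * (s n.+2 - s 1%N * s n.+1)).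
      by rewrite KE; ring.
    by rewrite rec subrr.
  have : (a + b * s 1%N) * (s 2%N - s 1%N ^+ 2) = 0.
    by rewrite expr2 mulrBr mulrCA !relation s0; ring.
  move/eqP; rewrite mulf_eq0 (negPf var_neq0) orbF => /eqP ab0.
  have /eqP := relation 0%N; rewrite ab0 mul0r s0 eq_sym oppr_eq0.
  by rewrite oner_eq0.
move=> n; set L := K - C * b in L_neq0 *.
have step m : L * s m.+2 = (K * s 1%N + C * a) * s m.+1 + C * s m.
  have -> : L * s m.+2 =
      K * (s m.+2 - s 1%N * s m.+1) - C * b * s m.+2 + K * s 1%N * s m.+1.
    by rewrite /L; ring.
  by rewrite rec; ring.
have CE : C = L * s 2%N - (K * s 1%N + C * a) * s 1%N by rewrite step s0; ring.
apply: (mulfI L_neq0); rewrite step [X in X * s n]CE.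
have -> : K = L + C * b by rewrite /L; ring.
by field.
Qed.

(** * Conditional expectations and variances *)

Section States.
Variables (R : realType) (A : starAlgType R[i]).
Variables (Phi : {scalar A}) (hPhi : is_state Phi).
Implicit Types (S X D Z : A) (P Q V : {poly R[i]}).

Lemma state_null_vector D : Phi (star D * D) = 0 -> forall Z, Phi (Z * D) = 0.
Proof. by case: hPhi => _; apply: null_vector. Qed.

Lemma star_horner_alg S P : self_adjoint S ->
  exists P', star (horner_alg S P) = horner_alg S P'.
Proof.
move=> hS; elim/poly_ind: P => [|P c [P' hP]].
  exists 0; rewrite !rmorph0; apply: (addrI (star 0)).
  by rewrite -starD !addr0.
exists ('X * P' + (Num.conj c)%:P).
by rewrite !rmorphD !rmorphM /= !horner_algX !horner_algC starD starM starZ star1 hP hS.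
Qed.

(** Two versions of a conditional expectation differ by a null vector: their
difference is itself a polynomial in S, and is orthogonal to all of them. *)
Lemma cond_exp_unique S Z Q Q' : self_adjoint S ->
  cond_exp_eq Phi S Z Q -> cond_exp_eq Phi S Z Q' ->
  forall W, Phi (W * (horner_alg S Q - horner_alg S Q')) = 0.
Proof.
move=> hS hQ hQ'; apply: state_null_vector.
rewrite -rmorphB; have [P ->] := star_horner_alg (Q - Q') hS.
by rewrite rmorphB mulrBr linearB /= -hQ -hQ' subrr.
Qed.

(** The conditional variance can be computed with any given version Q of the
conditional expectation, so that the regression and the variance hypotheses
speak of the same polynomial. *)
Lemma cond_var_with S X Q V : self_adjoint S ->
  cond_exp_eq Phi S X Q -> cond_var_eq Phi S X V ->
  cond_exp_eq Phi S ((X - horner_alg S Q) ^+ 2) V.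
Proof.
move=> hS hQ [Q' hQ' hV] P; rewrite -hV.
have hD := cond_exp_unique hS hQ hQ'.
have hXQ' T : Phi (horner_alg S T * (X - horner_alg S Q')) = 0.
  by rewrite mulrBr linearB /= hQ' subrr.
set D := horner_alg S Q - horner_alg S Q' in hD.
have -> : X - horner_alg S Q = X - horner_alg S Q' - D.
  by rewrite /D opprB addrA subrK.
set E := X - horner_alg S Q' in hXQ' *.
have hED W : Phi (W * (E - D)) = Phi (W * E).
  by rewrite mulrBr linearB /= hD subr0.
rewrite !expr2 mulrA hED -mulrA mulrBl mulrBr linearB /=.
by rewrite (mulrA _ D) /D -rmorphB -rmorphM hXQ' subr0.
Qed.

Lemma cond_exp_moments S Z Q n : cond_exp_eq Phi S Z Q ->
  Phi (S ^+ n * Z) = Phi (S ^+ n * horner_alg S Q).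
Proof. by move/(_ ('X ^+ n)); rewrite rmorphXn /= horner_algX. Qed.

Lemma horner_alg_affine S (k k0 : R[i]) :
  horner_alg S (k *: 'X + k0%:P) = k *: S + k0%:A.
Proof. by rewrite rmorphD /= linearZ /= horner_algX horner_algC mulr_algl. Qed.

Lemma cond_exp_affine_moments S Z (k k0 : R[i]) n :
    cond_exp_eq Phi S Z (k *: 'X + k0%:P) ->
  Phi (S ^+ n * Z) = k * Phi (S ^+ n.+1) + k0 * Phi (S ^+ n).
Proof.
move/(cond_exp_moments n) ->; rewrite horner_alg_affine.
by rewrite mulrDr -!scalerAr mulr1 -exprSr linearD !scalarZ.
Qed.

(** Pythagoras: Z - Q(S) is orthogonal to polynomials in S standing on its left,
so of the four terms of the square only those with Z as the first factor
remain. *)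
Lemma cond_exp_residual_square S Z Q n : cond_exp_eq Phi S Z Q ->
  Phi (S ^+ n * (Z - horner_alg S Q) ^+ 2) =
  Phi (S ^+ n * Z ^+ 2) - Phi (S ^+ n * Z * horner_alg S Q).
Proof.
move=> hQ; set L := horner_alg S Q.
have hL : Phi (S ^+ n * L * (Z - L)) = 0.
  have := hQ ('X ^+ n * Q); rewrite rmorphM rmorphXn /= horner_algX -/L => hLL.
  by rewrite mulrBr linearB /= hLL subrr.
rewrite [in LHS]expr2 [X in _ * X]mulrBl mulrBr linearB /= [X in _ - Phi X]mulrA hL subr0.
by rewrite expr2 !mulrBr linearB /= !mulrA.
Qed.

(** * Two-point distributions *)

(** If the variance v were zero, X - x would be a null vector; since P(X) - P(x)
is a multiple of X - x, the distribution of X would be the point mass at x. *)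
Lemma non_degenerate_variance X : self_adjoint X -> non_degenerate Phi X ->
  exists x v : R, [/\ Phi X = x%:C%C, Phi (X ^+ 2) = (x ^+ 2 + v)%:C%C & 0 < v].
Proof.
move=> hX nd.
have /complex_realP[x hx] : Phi X \is Num.real.
  by apply/CrealP; rewrite -state_star // hX.
pose D := X - x%:C%C%:A.
have sD : star D = D.
  rewrite /D -[- _]scaleN1r starD !starZ star1 hX rmorphN rmorph1; congr (_ + _ *: (_ *: _)).
  by apply/conj_Creal/complex_realP; exists x.
have D2 : Phi (star D * D) = Phi (X ^+ 2) - x%:C%C ^+ 2.
  rewrite sD /D mulrBr !mulrBl mulr_algr !mulr_algl !linearB !scalarZ /= hx.
  by rewrite (state_unital hPhi) -expr2; ring.
have D_ge0 := state_pos hPhi D.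
have /complex_realP[v hv] := ger0_real D_ge0.
exists x, v; split => //.
  by rewrite rmorphD rmorphXn /= -hv D2 addrC subrK.
rewrite hv ler0c le_eqVlt in D_ge0; case/orP: D_ge0 => // /eqP v0.
have D0 : Phi (star D * D) = 0 by rewrite hv -v0.
case: nd; exists x => P; rewrite /distribution.
have /factor_theorem[Q hQ] : root (P - P.[x%:C%C]%:P) x%:C%C.
  by rewrite rootE !hornerE subrr.
have -> : P = Q * ('X - x%:C%C%:P) + P.[x%:C%C]%:P by rewrite -hQ subrK.
rewrite rmorphD rmorphM rmorphB /= horner_algX !horner_algC linearD /=.
rewrite state_null_vector // add0r scalarZ (state_unital hPhi) mulr1.
by rewrite !hornerE subrr mulr0 add0r.
Qed.

Lemma distribution_moments X P :
  distribution Phi X P = \sum_(i < size P) P`_i * Phi (X ^+ i).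
Proof.
rewrite /distribution -[in LHS](coefK P) poly_def !linear_sum; apply: eq_bigr => i _.
by rewrite linearZ /= mulr_algl scalarZ rmorphXn /= horner_algX.
Qed.

(** The characteristic polynomial (t - x)(t - c) - v is negative at the mean x,
hence has real roots w < x < u, and the weight (x - w) / (u - w) that gives
the two-point measure the mean x lies strictly between 0 and 1.  Moments of
order 0 and 1 then determine the others. *)
Lemma bernoulli_of_recurrence X (x c v : R) :
    0 < v -> Phi X = x%:C%C ->
    (forall n, Phi (X ^+ n.+2) =
      (x%:C%C + c%:C%C) * Phi (X ^+ n.+1)
      - (c%:C%C * x%:C%C - v%:C%C) * Phi (X ^+ n)) ->
  bernoulli Phi X.
Proof.
move=> v_gt0 hx rec.
pose d := Num.sqrt ((x - c) ^+ 2 + 4 * v).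
have d2 : d ^+ 2 = (x - c) ^+ 2 + 4 * v by rewrite sqr_sqrtr //; have := sqr_ge0 (x - c); lra.
have d_gt : `|x - c| < d.
  by rewrite -(ltr_pXn2r (n := 2)) ?nnegrE ?sqrtr_ge0 // real_normK ?num_real // d2; lra.
have /andP[dl dr] : - d < x - c < d by rewrite -ltr_norml.
have d_gt0 : 0 < d by lra.
pose u := (x + c + d) / 2; pose w := (x + c - d) / 2.
pose p := (x - w) / (u - w).
have uwE : u - w = d by rewrite /u /w; field.
exists u, w, p; split.
- by rewrite -subr_eq0 uwE gt_eqF.
- by rewrite /p uwE divr_gt0 // /w; lra.
- by rewrite /p uwE ltr_pdivrMr // /w; lra.
have meanE : p * u + (1 - p) * w = x.
  by rewrite /p uwE /u /w; field; rewrite gt_eqF.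
have hu : u ^+ 2 = (x + c) * u - (c * x - v) by rewrite /u; nra.
have hw : w ^+ 2 = (x + c) * w - (c * x - v) by rewrite /w; nra.
have moments n : Phi (X ^+ n) = (p * u ^+ n + (1 - p) * w ^+ n)%:C%C.
  suff : Phi (X ^+ n) = (p * u ^+ n + (1 - p) * w ^+ n)%:C%C /\
         Phi (X ^+ n.+1) = (p * u ^+ n.+1 + (1 - p) * w ^+ n.+1)%:C%C by case.
  elim: n => [|n [IH0 IH1]].
    split; last by rewrite !expr1 meanE.
    by rewrite !expr0 (state_unital hPhi) !mulr1 addrC subrK.
  split=> //; rewrite rec IH0 IH1 -!(rmorphM, rmorphD, rmorphB) /=.
  by congr (_%:C)%C; rewrite (exprD u 2 n) (exprD w 2 n) hu hw !exprS; ring.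
move=> P; rewrite distribution_moments !horner_coef !mulr_sumr -big_split /=.
apply: eq_bigr => i _.
by rewrite moments !(rmorphM, rmorphD, rmorphXn) /=; ring.
Qed.

(** * Mixed moments under Boolean independence *)

Lemma boolean_independent_sym X Y :
  boolean_independent Phi X Y -> boolean_independent Phi Y X.
Proof.
move=> ind s hs hpos.
have := ind [seq (~~ u.1, u.2) | u <- s].
rewrite sorted_map all_map !big_map /=.
rewrite (eq_sorted (e' := fun u w : bool * nat => u.1 != w.1)); last first.
  by move=> [[] ?] [[] ?].
move=> /(_ hs hpos).
under eq_bigr => u _ do rewrite if_neg.
by under [RHS]eq_bigr => u _ do rewrite if_neg.
Qed.

(** A power of X + Y in front of an alternating product interacts only with the
first factor u.  By induction on n: of the two letters that can precede u,
one is absorbed in its exponent and the other starts a new factor, and in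
both cases the tail t still splits off. *)
Lemma boolean_power_sum X Y n (u : bool * nat) t :
    boolean_independent Phi X Y ->
    sorted (fun u w => u.1 != w.1) (u :: t) -> all (fun u => (0 < u.2)%N) (u :: t) ->
  Phi ((X + Y) ^+ n * \prod_(w <- u :: t) (if w.1 then X else Y) ^+ w.2) =
  Phi ((X + Y) ^+ n * (if u.1 then X else Y) ^+ u.2)
    * \prod_(w <- t) Phi ((if w.1 then X else Y) ^+ w.2).
Proof.
move=> ind; elim: n u t => [|n IHn] [e v] t ht hpos.
  by rewrite !mul1r ind // big_cons.
pose z (e : bool) := if e then X else Y.
have -> : X + Y = z e + z (~~ e) by case: (e) => //=; rewrite addrC.
have zS : z e + z (~~ e) = X + Y by case: (e) => //=; rewrite addrC.
have same s : z e * (z e ^+ v * s) = z e ^+ v.+1 * s by rewrite mulrA -exprS.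
rewrite big_cons /= -/(z e) exprSr -!mulrA !mulrDl !mulrDr !linearD /= zS same -exprS.
have := IHn (e, v.+1) t; rewrite big_cons /= -/(z e) => ->; last 2 first.
- by case: t ht {hpos}.
- by case/andP: hpos.
have := IHn (~~ e, 1%N) ((e, v) :: t).
have := IHn (~~ e, 1%N) [:: (e, v)].
rewrite !big_cons /= !big_nil /= -/(z e) -/(z (~~ e)) expr1 !mulr1.
have -> : ~~ e != e by case: (e).
move: hpos; rewrite /= => /andP[-> ->] -> // -> //.
by rewrite mulrDl mulrA.
Qed.

(** This trades a power of X on the right for a power of X + Y on the left, and
so computes all Phi((X + Y)^n X^k) recursively. *)
Lemma boolean_strip_left X Y n k : boolean_independent Phi X Y ->
  Phi ((X + Y) ^+ n * X ^+ k.+1) =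
  Phi ((X + Y) ^+ n.+1 * X ^+ k) - Phi ((X + Y) ^+ n * Y) * Phi (X ^+ k).
Proof.
move=> ind; rewrite [in RHS]exprSr -mulrA mulrDl mulrDr linearD /= -exprS.
apply/esym/eqP; rewrite subr_eq; apply/eqP; congr (_ + _).
case: k => [|k]; first by rewrite expr0 (state_unital hPhi) !mulr1.
have := boolean_power_sum n (u := (false, 1%N)) (t := [:: (true, k.+1)]) ind.
by rewrite !big_cons !big_nil /= expr1 !mulr1 => ->.
Qed.

Lemma power_sum_right X Y n : Phi ((X + Y) ^+ n * Y) =
  Phi ((X + Y) ^+ n.+1) - Phi ((X + Y) ^+ n * X).
Proof. by rewrite exprSr mulrDr linearD /= addrAC subrr add0r. Qed.

Lemma boolean_strip_right X Y n : boolean_independent Phi X Y ->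
  Phi ((X + Y) ^+ n * X * Y) = Phi ((X + Y) ^+ n * X) * Phi Y.
Proof.
have := boolean_power_sum n (u := (true, 1%N)) (t := [:: (false, 1%N)]).
by move=> /[apply]; rewrite !big_cons !big_nil /= !expr1 !mulr1 mulrA => ->.
Qed.

(** * The recurrence for the sum *)

(** Since the mean of X is alpha Phi(X + Y) + alpha0, the coefficient
(1 - alpha) Phi(X) - alpha Phi(Y) - alpha0 of Phi((X + Y)^n X) vanishes, and
the conditional variance only involves moments of X + Y. *)
Lemma cond_var_moments X Y (alpha alpha0 C a b : R[i]) n :
    self_adjoint (X + Y) ->
    boolean_independent Phi X Y ->
    cond_exp_eq Phi (X + Y) X (alpha *: 'X + alpha0%:P) ->
    cond_var_eq Phi (X + Y) X (C *: (1 + a *: 'X + b *: 'X^2)) ->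
  alpha * (1 - alpha)
    * (Phi ((X + Y) ^+ n.+2) - Phi (X + Y) * Phi ((X + Y) ^+ n.+1)) =
  C * (Phi ((X + Y) ^+ n) + a * Phi ((X + Y) ^+ n.+1) + b * Phi ((X + Y) ^+ n.+2)).
Proof.
move=> hS ind hexp hvar.
have hX m := cond_exp_affine_moments m hexp.
have hx : Phi X = alpha * Phi (X + Y) + alpha0.
  by have := hX 0; rewrite mul1r expr1 expr0 (state_unital hPhi) mulr1.
have hXY : Phi ((X + Y) ^+ n * X * Y) = Phi ((X + Y) ^+ n * X) * Phi Y.
  exact: boolean_strip_right.
have hXX : Phi ((X + Y) ^+ n * X ^+ 2) =
    Phi ((X + Y) ^+ n.+1 * X)
    - (Phi ((X + Y) ^+ n.+1) - Phi ((X + Y) ^+ n * X)) * Phi X.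
  by rewrite boolean_strip_left // expr1 power_sum_right.
have hXS : Phi ((X + Y) ^+ n * X * (X + Y)) =
    Phi ((X + Y) ^+ n * X ^+ 2) + Phi ((X + Y) ^+ n * X) * Phi Y.
  by rewrite mulrDr linearD /= hXY -mulrA -expr2.
have hV : Phi ((X + Y) ^+ n * horner_alg (X + Y) (C *: (1 + a *: 'X + b *: 'X^2))) =
    C * (Phi ((X + Y) ^+ n) + a * Phi ((X + Y) ^+ n.+1) + b * Phi ((X + Y) ^+ n.+2)).
  rewrite linearZ /= mulr_algl -scalerAr scalarZ !rmorphD /= !linearZ /= rmorph1 rmorphXn /= horner_algX.
  by rewrite !mulr_algl !mulrDr -!scalerAr mulr1 -exprSr -exprD addn2 !linearD !scalarZ /= !mulrDr.
have hXL : Phi ((X + Y) ^+ n * X * horner_alg (X + Y) (alpha *: 'X + alpha0%:P)) =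
    alpha * Phi ((X + Y) ^+ n * X * (X + Y)) + alpha0 * Phi ((X + Y) ^+ n * X).
  by rewrite horner_alg_affine mulrDr mulr_algr -scalerAr linearD !scalarZ.
rewrite -hV -(cond_exp_moments n (cond_var_with hS hexp hvar)).
rewrite (cond_exp_residual_square n hexp) hXL hXS hXX !hX.
have -> : Phi Y = Phi (X + Y) - Phi X by rewrite linearD /= addrAC subrr add0r.
by rewrite hx; ring.
Qed.

(** * From the sum to its summands *)

(** The recurrence is first shown for Phi((X + Y)^n X^k), for all n.  For k = 0
everything is expressed through the moments of X + Y, whose recurrence has
the same c; [boolean_strip_left] then raises k, since it turns the claim for
k + 1 at n into the claim for k at n + 1 and at 0. *)
Lemma summand_recurrence X Y (alpha alpha0 x c v : R[i]) :
    boolean_independent Phi X Y ->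
    (forall n, Phi ((X + Y) ^+ n * X) =
       alpha * Phi ((X + Y) ^+ n.+1) + alpha0 * Phi ((X + Y) ^+ n)) ->
    Phi X = x ->
    (forall n, Phi ((X + Y) ^+ n.+2) =
       (Phi (X + Y) + c) * Phi ((X + Y) ^+ n.+1)
       - (c * Phi (X + Y) - v) * Phi ((X + Y) ^+ n)) ->
  forall k, Phi (X ^+ k.+2) =
    (x + c) * Phi (X ^+ k.+1) - (c * x - alpha * v) * Phi (X ^+ k).
Proof.
move=> ind hX hx hS k.
have hxS : x = alpha * Phi (X + Y) + alpha0.
  by have := hX 0; rewrite mul1r expr1 expr0 (state_unital hPhi) mulr1 hx.
suff mixed n : Phi ((X + Y) ^+ n * X ^+ k.+2) =
    (x + c) * Phi ((X + Y) ^+ n * X ^+ k.+1)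
    - (c * x - alpha * v) * Phi ((X + Y) ^+ n * X ^+ k).
  by have := mixed 0; rewrite !mul1r.
elim: k n => [|k IHk] n.
  by rewrite boolean_strip_left // power_sum_right expr1 expr0 mulr1 !hX hx hS hxS; ring.
rewrite !(boolean_strip_left n) // IHk.
by have := IHk 0; rewrite !mul1r => ->; ring.
Qed.

End States.

Theorem proposition9 (R : realType) (A : starAlgType R[i])
    (Phi : {scalar A}) (hPhi : is_state Phi)
    (X Y : A) (hX : self_adjoint X) (hY : self_adjoint Y)
    (ndX : non_degenerate Phi X) (ndY : non_degenerate Phi Y)
    (indXY : boolean_independent Phi X Y)
    (alpha alpha0 C a b : R)
    (hexp : cond_exp_eq Phi (X + Y) X
              (alpha%:C%C *: 'X + (alpha0%:C%C)%:P))
    (hvar : cond_var_eq Phi (X + Y) X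
              (C%:C%C *: (1 + a%:C%C *: 'X + b%:C%C *: 'X^2))) :
  bernoulli Phi X /\ bernoulli Phi Y.
Proof.
have [x [v [hx hx2 v_gt0]]] := non_degenerate_variance hPhi hX ndX.
have [y [w [hy hy2 w_gt0]]] := non_degenerate_variance hPhi hY ndY.
have hS : self_adjoint (X + Y) by rewrite /self_adjoint starD hX hY.
have hs1 : Phi (X + Y) = (x + y)%:C%C by rewrite linearD /= hx hy rmorphD.
have hYX : boolean_independent Phi Y X := boolean_independent_sym indXY.
have hXm n := cond_exp_affine_moments n hexp.
have hYm n : Phi ((Y + X) ^+ n * Y) =
    (1 - alpha%:C%C) * Phi ((Y + X) ^+ n.+1) + (- alpha0%:C%C) * Phi ((Y + X) ^+ n).
  by rewrite ![Y + X]addrC power_sum_right hXm; ring.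
have hXY : Phi (X * Y) = (x * y)%:C%C.
  by have := boolean_strip_right 0 indXY; rewrite expr0 !mul1r hx hy -rmorphM.
have hYX2 : Phi (Y * X) = (x * y)%:C%C.
  by have := boolean_strip_right 0 hYX; rewrite expr0 !mul1r hx hy mulrC -rmorphM.
have hs2 : Phi ((X + Y) ^+ 2) = ((x + y) ^+ 2 + (v + w))%:C%C.
  rewrite expr2 mulrDl !mulrDr -!expr2 !linearD /= hx2 hy2 hXY hYX2 -!rmorphD /=.
  by congr (_%:C)%C; ring.
have xE : x = alpha * (x + y) + alpha0.
  apply: complexI; have := hXm 0.
  by rewrite mul1r expr1 expr0 (state_unital hPhi) mulr1 hx hs1 !(rmorphD, rmorphM).
(* Phi((X + Y) X), by independence and by the regression, determines Var X *)
have vE : v = alpha * (v + w).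
  have : x ^+ 2 + v + x * y = alpha * ((x + y) ^+ 2 + (v + w)) + alpha0 * (x + y).
    apply: complexI; have := hXm 1.
    rewrite expr1 hs2 hs1 mulrDl -expr2 linearD /= hx2 hYX2.
    by rewrite !(rmorphD, rmorphM).
  have -> : alpha0 = x - alpha * (x + y) by rewrite {1}xE addrAC subrr add0r.
  move/eqP; rewrite -subr_eq0 => /eqP h.
  by apply/eqP; rewrite -subr_eq0 -h; apply/eqP; ring.
have wE : w = (1 - alpha) * (v + w) by rewrite mulrBl mul1r -vE addrAC subrr add0r.
have [c hrec] : exists c : R, forall n, Phi ((X + Y) ^+ n.+2) =
    (Phi (X + Y) + c%:C%C) * Phi ((X + Y) ^+ n.+1)
    - (c%:C%C * Phi (X + Y) - (v + w)%:C%C) * Phi ((X + Y) ^+ n).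
  exists (C * (a + b * (x + y)) / (alpha * (1 - alpha) - C * b)) => n.
  have alpha_neq0 : alpha != 0 by apply/eqP => h; move: vE; rewrite h; lra.
  have alpha_neq1 : 1 - alpha != 0 by apply/eqP => h; move: wE; rewrite h; lra.
  have varE : (v + w)%:C%C = Phi ((X + Y) ^+ 2) - Phi (X + Y) ^+ 2.
    by rewrite hs2 hs1 -rmorphXn -rmorphB /= addrAC subrr add0r.
  have -> : (C * (a + b * (x + y)) / (alpha * (1 - alpha) - C * b))%:C%C =
      C%:C%C * (a%:C%C + b%:C%C * Phi (X + Y))
        / (alpha%:C%C * (1 - alpha%:C%C) - C%:C%C * b%:C%C).
    by rewrite hs1 rmorphM fmorphV !(rmorphB, rmorphD, rmorphM, rmorph1).
  rewrite varE; apply: (moment_recurrence (s := fun m => Phi ((X + Y) ^+ m)) _ _ _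
    (fun m => cond_var_moments hPhi m hS indXY hexp hvar)).
  - by rewrite expr0 (state_unital hPhi).
  - rewrite expr1 -varE -(rmorph0 (real_complex R)) (inj_eq (@complexI R)).
    by rewrite gt_eqF // addr_gt0.
  rewrite -(rmorph1 (real_complex R)) -rmorphB -rmorphM.
  by rewrite -(rmorph0 (real_complex R)) (inj_eq (@complexI R)) mulf_neq0.
split.
  apply: (bernoulli_of_recurrence hPhi (c := c) v_gt0 hx) => n.
  rewrite [in RHS]vE rmorphM /=.
  exact: (summand_recurrence hPhi indXY hXm hx hrec).
apply: (bernoulli_of_recurrence hPhi (c := c) w_gt0 hy) => n.
rewrite [in RHS]wE rmorphM rmorphB rmorph1 /=.
apply: (summand_recurrence hPhi hYX hYm hy) => m.
by rewrite ![Y + X]addrC.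
Qed.
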